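(* Let $Y$ be a Banach space over $\mathbb{K}$ having the BPB property in such a way that the relationship between $\varepsilon$ and $\delta$ does not depend on the subspace; that is, suppose that for every $\varepsilon>0$ there exists $\delta>0$ such that for every closed subspace $X$ of $Y$, whenever $x_0\in S_X$ and $y_0^*\in S_{Y^*}$ satisfy $\mathrm{Re}\,y_0^*(x_0)>1-\delta$, there exists $(x,y^* )\in\Pi(X,Y)$ with $\|x_0-x\|<\varepsilon$ and $\|y_0^*-y^*\|<\varepsilon$. Then $Y$ is uniformly smooth.
   Context: $\mathbb{K}$ is $\mathbb{R}$ or $\mathbb{C}$; $B_Y$, $S_Y$, $Y^*$ denote the closed unit ball, the unit sphere and the dual of $Y$. For a closed subspace $X$ of $Y$, $\Pi(X,Y)=\{(x,y^* )\in S_X\times S_{Y^*} : y^*(x)=1\}$. $Y$ is uniformly smooth if the limit $\lim_{\alpha\to 0}\frac{\|u+\alpha y\|-1}{\alpha}$ ($\alpha$ real) exists uniformly for $y\in B_Y$ and $u\in S_Y$. *)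

(* Defs.v *)
From mathcomp Require Import all_boot all_order all_algebra.
From mathcomp Require Import all_classical all_reals all_analysis.
Set Implicit Arguments.
Unset Strict Implicit.
Unset Printing Implicit Defensive.
Import Order.TTheory GRing.Theory Num.Theory.
Import numFieldNormedType.Exports.

Local Open Scope classical_set_scope.
Local Open Scope ring_scope.

(* The definitions are over a numFieldType K, to be used with K = R (a realType)
   and K = R[i].  As everywhere in normedModType K, norms (hence also epsilon
   and delta) are elements of K; in R[i], x <= y means that y - x is a
   nonnegative real, so 0 < e forces e to be real. *)

Definition unit_ball (K : numFieldType) (Y : normedModType K) : set Y :=
  [set y | `|y| <= 1].
Arguments unit_ball {K} Y.

Definition unit_sphere (K : numFieldType) (Y : normedModType K) : set Y :=
  [set y | `|y| = 1].
Arguments unit_sphere {K} Y.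

(* For continuous linear f the supremum exists, in R[i] too: the upper bounds
   of a nonempty set of reals are real. *)
Definition dual_norm (K : numFieldType) (Y : normedModType K) (f : Y -> K) : K :=
  supremum 0 [set `|f y| | y in unit_ball Y].

Definition dual_sphere (K : numFieldType) (Y : normedModType K) :
    set {linear Y -> K^o} :=
  [set f | continuous f /\ dual_norm f = 1].
Arguments dual_sphere {K} Y.

Definition closed_subspace (K : numFieldType) (Y : normedModType K)
    (X : set Y) : Prop :=
  submod_closed [pred y | y \in X] /\ closed X.

Definition Pi_set (K : numFieldType) (Y : normedModType K) (X : set Y) :
    set (Y * {linear Y -> K^o}) :=
  [set p | [/\ (X `&` unit_sphere Y) p.1, dual_sphere Y p.2
             & p.2 p.1 = 1]].

(* re is the real part on K: the identity for K = R, 'Re for K = R[i]. *)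
Definition uniform_BPB (K : numFieldType) (re : K -> K) (Y : normedModType K) :
    Prop :=
  forall e : K, 0 < e -> exists2 d : K, 0 < d &
    forall X : set Y, closed_subspace X ->
    forall (x0 : Y) (f0 : {linear Y -> K^o}),
      (X `&` unit_sphere Y) x0 -> dual_sphere Y f0 ->
      re (f0 x0) > 1 - d ->
      exists (x : Y) (f : {linear Y -> K^o}),
        [/\ Pi_set X (x, f), `|x0 - x| < e
          & dual_norm (fun y => f0 y - f y) < e].

(* Num.real restricts the increments a to real values when K = R[i]. *)
Definition uniformly_smooth (K : numFieldType) (Y : normedModType K) : Prop :=
  exists L : Y * Y -> K,
    {uniform unit_sphere Y `*` unit_ball Y,
      (fun (a : K) (p : Y * Y) => (`|p.1 + a *: p.2| - 1) / a)
        @ within [set a | a \is Num.real] (0 : K)^' --> L}.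

(* Main.v *)
From HB Require Import structures.
Require Import Defs.
From mathcomp Require Import all_boot all_order all_algebra.
From mathcomp Require Import all_classical all_reals all_analysis.
From mathcomp Require Import complex ring lra.
Import Order.TTheory GRing.Theory Num.Theory.
Import numFieldNormedType.Exports.
Local Open Scope classical_set_scope.
Local Open Scope ring_scope.

(** Applied to the lines $X = \mathbb{K} x$, the property says that a functional
    $g$ of norm one which is almost norming at a unit vector $x$ is close to a
    functional $h$ of the unit ball that is exactly norming at $x$: if $f$ has
    norm one and $f(c x) = 1$ with $|c| = 1$, take $h = c f$ ([BPB_one_point]).

    Let $u$ be a unit vector, $\|y\| \le 1$ and $t > 0$ small.  Take $g$ norming
    at $u + t y$ (Hahn-Banach); since $u - t y$ is near $u + t y$, the functional
    $g$ is almost norming at the direction of $u - t y$, hence is $e$-close to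
    some $h$ norming there.  Then
    $$\|u + t y\| + \|u - t y\| = \mathrm{Re}\, g(u + t y) + \mathrm{Re}\, h(u - t y)
      = \mathrm{Re}\, g(u) + \mathrm{Re}\, h(u) + t\, \mathrm{Re}\,(g - h)(y)
      \le 2 + t e$$
    with one bound on $t$ for all $u$ and $y$ ([BPB_second_difference]).

    This bound says that the right and left difference quotients of the norm at
    $u$ in the direction $y$ differ by at most $e$.  Every left quotient is below
    every right quotient, so the infimum of the right ones lies between them and
    is the uniform limit ([uniformly_smooth_of_second_difference]).

    Two points need preparation.  The Hahn-Banach theorem is proved by applying
    Zorn's lemma to sublinear functionals themselves, whose minimal elements are
    linear.  The real and the complex case are treated together by means of a
    record of what a field of scalars must provide, [real_part]. *)

(** * The Hahn-Banach theorem *)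

Lemma le_inf_add {R : realType} (E F : set R) (c : R) :
  E !=set0 -> F !=set0 -> (forall a b, E a -> F b -> c <= a + b) ->
  c <= inf E + inf F.
Proof.
move=> E0 F0 cEF; rewrite -lerBlDr; apply: lb_le_inf => // a Ea.
rewrite lerBlDr -lerBlDl; apply: lb_le_inf => // b Fb.
by rewrite lerBlDl cEF.
Qed.

Lemma le_mul_inf {R : realType} (E : set R) (c t : R) :
  E !=set0 -> 0 <= t -> (forall a, E a -> c <= t * a) -> c <= t * inf E.
Proof.
move=> E0; rewrite le_eqVlt => /predU1P[<-|t0] cE.
  by have [a /cE] := E0; rewrite !mul0r.
rewrite -ler_pdivrMl//; apply: lb_le_inf => // a /cE.
by rewrite ler_pdivrMl.
Qed.

(** Homogeneity is stated as the inequality that passes directly to infima;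
    equality follows, see [sublinearZ]. *)
Definition sublinear {R : realType} {V : lmodType R} (p : V -> R) : Prop :=
  (forall x y, p (x + y) <= p x + p y) /\
  (forall (t : R) x, 0 <= t -> p (t *: x) <= t * p x).

Lemma sublinearN {R : realType} {V : lmodType R} {p : V -> R} (x : V) :
  sublinear p -> - p (- x) <= p x.
Proof.
move=> [pD pZ]; have := pD x (- x); have := pD 0 0; rewrite subrr addr0.
lra.
Qed.

Lemma sublinearZ {R : realType} {V : lmodType R} {p : V -> R} (t : R) (x : V) :
  sublinear p -> 0 <= t -> p (t *: x) = t * p x.
Proof.
move=> [pD pZ]; rewrite le_eqVlt => /predU1P[<-|t0].
  have := pD 0 0; have := pZ 0 0 (lexx 0).
  by rewrite addr0 !scale0r !mul0r; lra.
apply/le_anti/andP; split; first by rewrite pZ// ltW.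
have tV0 : 0 <= t^-1 by rewrite invr_ge0 ltW.
have := pZ t^-1 (t *: x) tV0.
by rewrite scalerA mulVf ?gt_eqF// scale1r ler_pdivlMl.
Qed.

Definition tilt_set {R : realType} {V : lmodType R} (p : V -> R) (v x : V) :=
  [set p (x + t *: v) - t * p v | t in [set t : R | 0 <= t]].

(** The largest sublinear functional below $p$ whose value at $-v$ is at most
    $-p(v)$: a sublinear $q \le p$ with $q(-v) \le -p(v)$ satisfies
    $q(x) \le q(x + t v) + t q(-v) \le p(x + t v) - t p(v)$. *)
Definition tilt {R : realType} {V : lmodType R} (p : V -> R) (v x : V) : R :=
  inf (tilt_set p v x).

Section tilt.
Context {R : realType} {V : lmodType R} {p : V -> R} (v : V).
Context (p_sub : sublinear p).

Lemma tilt_le_at (t : R) x : 0 <= t -> tilt p v x <= p (x + t *: v) - t * p v.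
Proof.
move=> t0; apply: ge_inf; last by exists t.
exists (- p (- x)) => _ [s /= s0 <-].
have [pD pZ] := p_sub.
have := pD (x + s *: v) (- x).
by rewrite -(sublinearZ _ _ p_sub s0) (addrC x) addrK; lra.
Qed.

Lemma tilt_set_nonempty x : tilt_set p v x !=set0.
Proof. by eexists; exists 0 => //=. Qed.

Lemma tilt_le x : tilt p v x <= p x.
Proof. by have := tilt_le_at 0 x (lexx 0); rewrite scale0r addr0 mul0r subr0. Qed.

Lemma tilt_oppr : tilt p v (- v) <= - p v.
Proof.
apply: le_trans (tilt_le_at 1 _ ler01) _; rewrite scale1r addNr mul1r.
by have := p_sub.2 0 0 (lexx 0); rewrite scale0r mul0r; lra.
Qed.

Lemma tilt_sublinear : sublinear (tilt p v).
Proof.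
have [pD pZ] := p_sub.
split=> [x y|t x t0].
  apply: le_inf_add; [exact: tilt_set_nonempty..|].
  move=> _ _ [s /= s0 <-] [t /= t0 <-].
  apply: le_trans (tilt_le_at (s + t) _ (addr_ge0 s0 t0)) _.
  by have := pD (x + s *: v) (y + t *: v); rewrite scalerDl addrACA mulrDl; lra.
apply: le_mul_inf => //; first exact: tilt_set_nonempty.
move=> _ [s /= s0 <-].
apply: le_trans (tilt_le_at (t * s) _ (mulr_ge0 t0 s0)) _.
by rewrite -scalerA -scalerDr mulrBr -mulrA lerD2r; exact: pZ.
Qed.

End tilt.

(** Zorn's lemma for the reverse pointwise order: the pointwise infimum of a chain
    of sublinear functionals below $p$ is finite, since each of them is at
    least $-p(-x)$ at $x$, and subadditive, since any two members of the chain
    can be replaced by the smaller of them. *)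
Lemma minimal_sublinear_below {R : realType} {V : lmodType R} (p : V -> R) :
  sublinear p ->
  exists q, [/\ sublinear q, forall x, q x <= p x &
    forall r, sublinear r -> (forall x, r x <= q x) -> r = q].
Proof.
move=> p_sub.
pose T := {q : V -> R | sublinear q /\ forall x, q x <= p x}.
pose mkT q (q_sub : sublinear q) (qp : forall x, q x <= p x) : T :=
  exist _ q (conj q_sub qp).
pose below (q r : T) := `[< forall x, sval r x <= sval q x >].
have [|q r s /asboolP qr /asboolP rs||A Atot|[q [q_sub qp]] q_min] := @Zorn T below.
- by move=> q; apply/asboolP.
- by apply/asboolP => x; exact: le_trans (rs x) (qr x).
- move=> [q Pq] [r Pr] /asboolP qr /asboolP rq; apply: eq_exist.
  by apply/funext => x; apply/le_anti; rewrite qr rq.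
- have [[q0 Aq0]|A0] := pselect (A !=set0); last first.
    exists (mkT p p_sub (fun x => lexx (p x))) => s As.
    by exfalso; apply: A0; exists s.
  pose vals x := [set sval q x | q in A].
  have vals0 x : vals x !=set0 by exists (sval q0 x); exists q0.
  have m_le (q : T) x : A q -> inf (vals x) <= sval q x.
    move=> Aq; apply: ge_inf; last by exists q.
    exists (- p (- x)) => _ [[r [r_sub rp]] /= Ar <-].
    by apply: le_trans (sublinearN x r_sub); rewrite lerN2.
  have m_sub : sublinear (fun x => inf (vals x)).
    split=> [x y|t x t0].
      apply: le_inf_add => // _ _ [r Ar <-] [s As <-].
      have [/asboolP sr|/asboolP rs] := Atot _ _ Ar As.
        apply: le_trans (m_le _ _ As) _; apply: le_trans ((svalP s).1.1 x y) _.
        by rewrite lerD2r.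
      apply: le_trans (m_le _ _ Ar) _; apply: le_trans ((svalP r).1.1 x y) _.
      by rewrite lerD2l.
    apply: le_mul_inf => // _ [r Ar <-].
    by apply: le_trans (m_le _ _ Ar) _; exact: (svalP r).1.2.
  have m_p x : inf (vals x) <= p x.
    exact: le_trans (m_le _ _ Aq0) ((svalP q0).2 x).
  exists (mkT _ m_sub m_p) => s As; apply/asboolP => x.
  exact: m_le.
- exists q; split=> // r r_sub rq.
  have rp x : r x <= p x by exact: le_trans (rq x) (qp x).
  have := q_min (mkT r r_sub rp).
  by move=> /(_ (introT (asboolP _) rq))/(congr1 sval).
Qed.

(** A minimal sublinear functional $q$ equals all its tilts, so $q(-w) \le -q(w)$
    for every $w$, which makes it odd and thereby linear.  Starting the
    minimization from the tilt of $p$ along $v$ forces the value at $v$ to be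
    $p(v)$. *)
Theorem hahn_banach {R : realType} {V : lmodType R} (p : V -> R) (v : V) :
  sublinear p ->
  exists2 f : {linear V -> R^o}, (forall x, f x <= p x) & f v = p v.
Proof.
move=> p_sub.
have [q [q_sub q_le q_min]] := minimal_sublinear_below _ (tilt_sublinear v p_sub).
have tilt_q w : tilt q w = q.
  by apply: q_min => [|x]; [exact: tilt_sublinear|exact: tilt_le].
have qN w : q (- w) = - q w.
  apply/le_anti/andP; split; last by rewrite lerNl sublinearN.
  by rewrite -{1}(tilt_q w); exact: tilt_oppr.
have [qD qZ] := q_sub.
have q_additive x y : q (x + y) = q x + q y.
  apply/le_anti/andP; split=> //.
  by have := qD (- x) (- y); rewrite -opprD !qN; lra.
have q_homog0 t x : 0 <= t -> q (t *: x) = t * q x.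
  move=> t0; apply/le_anti/andP; split; first exact: qZ.
  by have := qZ t (- x) t0; rewrite scalerN !qN mulrN lerN2.
have q_homog t x : q (t *: x) = t * q x.
  have [/q_homog0//|t0] := leP 0 t.
  rewrite -[t]opprK scaleNr qN q_homog0 ?mulNr// oppr_ge0; exact: ltW.
have q_lin : linear (q : V -> R^o) by move=> t x y; rewrite q_additive q_homog.
pose qlin := GRing.isLinear.Build R V R^o *:%R q q_lin.
exists (HB.pack_for {linear V -> R^o} q qlin) => /= [x|].
  exact: le_trans (q_le x) (tilt_le v p_sub x).
apply/le_anti/andP; split; first exact: le_trans (q_le v) (tilt_le v p_sub v).
by rewrite -[leRHS]opprK -qN lerNr; apply: le_trans (q_le _) (tilt_oppr v p_sub).
Qed.

(** * Scalar fields with a real part *)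

(** A distinct name for $V$, so that its structure of module over $R$ does not
    compete with the one over $K$. *)
Definition restrict_scalars {R K : nzRingType} (emb : {rmorphism R -> K})
  (V : lmodType K) : Type := V.

Section restrict_scalars.
Context {R K : nzRingType} (emb : {rmorphism R -> K}) (V : lmodType K).
Local Notation W := (restrict_scalars emb V).

HB.instance Definition _ := GRing.Zmodule.on W.

Let scale (r : R) (v : W) : W := emb r *: (v : V).

Let scaleA (a b : R) (v : W) : scale a (scale b v) = scale (a * b) v.
Proof. by rewrite /scale scalerA rmorphM. Qed.

Let scale1 : left_id 1 scale.
Proof. by move=> v; rewrite /scale rmorph1 scale1r. Qed.

Let scaleDr : right_distributive scale +%R.
Proof. by move=> a u v; rewrite /scale scalerDr. Qed.

Let scaleDl (v : W) : {morph scale^~ v : a b / a + b}.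
Proof. by move=> a b; rewrite /scale rmorphD scalerDl. Qed.

HB.instance Definition _ :=
  GRing.Zmodule_isLmodule.Build R W scaleA scale1 scaleDr scaleDl.

Lemma restrict_scalarsE (r : R) (v : V) : r *: (v : W) = emb r *: v.
Proof. by []. Qed.

End restrict_scalars.

(** What the argument uses of the scalar fields $\mathbb{R}$ and $\mathbb{C}$: the
    reals embed in $K$ as its real elements, [re] is a real-linear retraction
    onto them with $\mathrm{Re}\, z \le |z|$, and every real-linear functional on a
    $K$-module is the real part of a $K$-linear one.  The last field is what
    carries the real Hahn-Banach theorem over to $K$. *)
Record real_part (R : realType) (K : numFieldType) := RealPart {
  emb : {rmorphism R -> K};
  re : {additive K -> R};
  ler_emb : forall r s, (emb r <= emb s) = (r <= s);
  embK : cancel emb re;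
  reK : forall z, z \is Num.real -> emb (re z) = z;
  re_emb_mul : forall r z, re (emb r * z) = r * re z;
  emb_re_le_norm : forall z, emb (re z) <= `|z|;
  linear_of_re : forall (V : lmodType K)
      (g : {linear restrict_scalars emb V -> R^o}),
    exists f : {linear V -> K^o}, forall v, re (f v) = g v }.


Arguments emb {R K} _.
Arguments re {R K} _.
Arguments ler_emb {R K} _.
Arguments embK {R K} _.
Arguments reK {R K} _.
Arguments re_emb_mul {R K} _.
Arguments emb_re_le_norm {R K} _.
Arguments linear_of_re {R K} _ {V} _.

Lemma linear_of_re_real {R : realType} (V : lmodType R)
    (g : {linear restrict_scalars (idfun : {rmorphism R -> R}) V -> R^o}) :
  exists f : {linear V -> R^o}, forall v, f v = g v.
Proof.
have g_lin : linear (g : V -> R^o).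
  by move=> r u v; have := linearP g r u v; rewrite restrict_scalarsE.
pose glin := GRing.isLinear.Build R V R^o *:%R (g : V -> R^o) g_lin.
by exists (HB.pack_for {linear V -> R^o} (g : V -> R^o) glin).
Qed.

Definition real_real_part (R : realType) : real_part R R :=
  @RealPart R R idfun idfun (fun r s => erefl) (fun r => erefl)
    (fun z _ => erefl) (fun r z => erefl) (@ler_norm R) linear_of_re_real.

Lemma complex_Re_zmod_morphism (R : realType) :
  zmod_morphism (@complex.Re R : R[i] -> R).
Proof. by move=> [a b] [c d]. Qed.

HB.instance Definition _ (R : realType) :=
  GRing.isZmodMorphism.Build R[i] R (@complex.Re R) (@complex_Re_zmod_morphism R).

Lemma Re_real_complex_mul {R : realType} (r : R) (z : R[i]) :
  complex.Re (r%:C%C * z) = r * complex.Re z.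
Proof. by case: z => a b /=; rewrite mul0r subr0. Qed.

Lemma Re_le_normc {R : realType} (z : R[i]) : (complex.Re z)%:C%C <= `|z|.
Proof. by apply: le_trans (normc_ge_Re z); rewrite lecR ler_norm. Qed.

(** The complex-linear functional with real part $g$ is
    $v \mapsto g(v) - i g(i v)$. *)
Lemma linear_of_re_complex {R : realType} (V : lmodType R[i])
    (g : {linear restrict_scalars (real_complex R) V -> R^o}) :
  exists f : {linear V -> R[i]^o}, forall v, complex.Re (f v) = g v.
Proof.
pose f (v : V) : R[i]^o := (g v +i* - g ('i%C *: v))%C.
have gD (u v : V) : g (u + v) = g u + g v by exact: (raddfD g).
have gZ (r : R) (v : V) : g (r%:C%C *: v) = r * g v by exact: (linearZ_LR g).
have fD (u v : V) : f (u + v) = f u + f v.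
  by rewrite /f scalerDr !gD; apply/eqP; rewrite eq_complex /= opprD !eqxx.
have gZC (a b : R) (v : V) : g ((a +i* b)%C *: v) = a * g v + b * g ('i%C *: v).
  rewrite (_ : (a +i* b)%C = a%:C%C + b%:C%C * 'i%C).
    by rewrite scalerDl gD -scalerA !gZ.
  by apply/eqP; rewrite eq_complex /=; apply/andP; split; apply/eqP; ring.
have iM a b : ('i%C : R[i]) * (a +i* b)%C = (- b +i* a)%C.
  by apply/eqP; rewrite eq_complex /=; apply/andP; split; apply/eqP; ring.
have fZ a b (v : V) : f ((a +i* b)%C *: v) = (a +i* b)%C * (f v : R[i]).
  have gi : g ('i%C *: ((a +i* b)%C *: v)) = - b * g v + a * g ('i%C *: v).
    by rewrite scalerA iM gZC.
  rewrite /f gZC gi.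
  by apply/eqP; rewrite eq_complex /=; apply/andP; split; apply/eqP; ring.
have f_lin : linear f by move=> [a b] u v; rewrite fD fZ.
pose flin := GRing.isLinear.Build R[i] V R[i]^o *:%R f f_lin.
by exists (HB.pack_for {linear V -> R[i]^o} f flin).
Qed.

Definition complex_real_part (R : realType) : real_part R R[i] :=
  @RealPart R R[i] (real_complex R) (@complex.Re R) (@lecR R) (fun r => erefl)
    (@RRe_real R) Re_real_complex_mul Re_le_normc linear_of_re_complex.

Section real_part_theory.
Context {R : realType} {K : numFieldType} (P : real_part R K).

Lemma ltr_emb r s : (emb P r < emb P s) = (r < s).
Proof. by rewrite !lt_neqAle ler_emb (can_eq (embK P)). Qed.

Lemma normr_emb r : `|emb P r| = emb P `|r|.
Proof.
have [r0|r0] := leP 0 r.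
  by rewrite !ger0_norm// -(rmorph0 (emb P)) ler_emb.
by rewrite !ltr0_norm ?rmorphN// -(rmorph0 (emb P)) ltr_emb.
Qed.

Lemma re_le_norm z r : `|z| <= emb P r -> re P z <= r.
Proof. by move=> zr; rewrite -(ler_emb P) (le_trans (emb_re_le_norm P z)). Qed.

Lemma re_mono x y : x \is Num.real -> y \is Num.real -> x <= y ->
  re P x <= re P y.
Proof. by move=> xr yr; rewrite -(ler_emb P) !reK. Qed.

Lemma re_gt0 z : 0 < z -> 0 < re P z.
Proof.
by move=> z0; rewrite -ltr_emb reK ?rmorph0// gtr0_real.
Qed.

End real_part_theory.

(** Stated for partial orders, because the order of $\mathbb{C}$ is not total. *)
Lemma supremum_eq {d : Order.disp_t} {T : porderType d} (x0 l : T) (A : set T) :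
  A !=set0 -> supremums A l -> supremum x0 A = l.
Proof.
move=> /set0P/negbTE A0 Al; rewrite /supremum A0.
exact: xget_subset1 Al (@is_subset1_supremums _ _ A).
Qed.

(** * The dual norm *)

Section dual_norm.
Context {R : realType} {K : numFieldType} (P : real_part R K).
Context {Y : normedModType K}.

(** The supremum defining the dual norm is that of a bounded set of real elements
    of $K$, hence the image of a supremum taken in the reals; in particular it
    exists, so that the default value $0$ does not occur. *)
Lemma dual_norm_ge {F : Y -> K} {M : K} :
  (forall y, `|y| <= 1 -> `|F y| <= M) ->
  forall y, `|y| <= 1 -> `|F y| <= dual_norm F.
Proof.
move=> FM y y1.
have B0 : `|0 : Y| <= 1 by rewrite normr0.
have M_real : M \is Num.real by apply/ger0_real/(le_trans _ (FM _ B0)).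
pose S := [set re P `|F y| | y in unit_ball Y].
have S_ub : has_ubound S.
  by exists (re P M) => _ [z z1 <-]; apply: re_mono; rewrite ?FM ?normr_real.
suff sup_emb : dual_norm F = emb P (sup S).
  rewrite sup_emb -(reK P _ (normr_real (F y))) ler_emb.
  by apply: ub_le_sup => //; exists y.
apply: supremum_eq; first by exists `|F 0|, 0.
split=> [_ [z z1 <-]|b b_ub].
  rewrite -(reK P _ (normr_real (F z))) ler_emb; apply: ub_le_sup => //.
  by exists z.
have b_real : b \is Num.real.
  by apply/ger0_real/(le_trans (normr_ge0 (F 0)))/b_ub; exists 0.
rewrite -(reK P _ b_real) ler_emb; apply: ge_sup.
  by exists (re P `|F 0|), 0.
by move=> _ [z z1 <-]; apply: re_mono => //; apply: b_ub; exists z.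
Qed.

Lemma dual_norm_eq1 {F : Y -> K} :
  (forall y, `|y| <= 1 -> `|F y| <= 1) ->
  (exists2 y, `|y| <= 1 & `|F y| = 1) -> dual_norm F = 1.
Proof.
move=> F_le1 [y y1 Fy1]; apply: supremum_eq; first by exists `|F y|, y.
split=> [_ [z z1 <-]|b]; first exact: F_le1.
by rewrite -Fy1; apply; exists y.
Qed.

Lemma dual_sphere_le {f : {linear Y -> K^o}} :
  dual_sphere Y f -> forall y, `|y| <= 1 -> `|f y| <= 1.
Proof.
move=> [/linear_bounded_continuous/bounded_funP/(_ 1) [M fM] f1] y y1.
by rewrite -f1; apply: (dual_norm_ge fM).
Qed.

End dual_norm.

(** * Norming functionals *)

Section norming.
Context {R : realType} {K : numFieldType} (P : real_part R K).
Context {Y : normedModType K}.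

(** Norms take their values in $K$; the estimates are made on this real copy. *)
Definition real_norm (y : Y) : R := re P `|y|.
Local Notation N := real_norm.

Lemma emb_real_norm y : emb P (N y) = `|y|.
Proof. by rewrite reK ?normr_real. Qed.

Lemma real_normD x y : N (x + y) <= N x + N y.
Proof. by rewrite -(ler_emb P) rmorphD !emb_real_norm ler_normD. Qed.

Lemma real_normZ (r : R) y : N (emb P r *: y) = `|r| * N y.
Proof. by rewrite /N normrZ normr_emb re_emb_mul. Qed.

Lemma real_normN y : N (- y) = N y.
Proof. by rewrite /N normrN. Qed.

Lemma real_norm_unit y : `|y| = 1 -> N y = 1.
Proof. by rewrite /N => ->; rewrite -(rmorph1 (emb P)) embK. Qed.

Lemma real_norm_le1 y : `|y| <= 1 -> N y <= 1.
Proof. by rewrite -(ler_emb P) emb_real_norm rmorph1. Qed.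

(** Hahn-Banach for the norm gives a real-linear $G \le \|\cdot\|$ with
    $G(a) = \|a\|$, the real part of some $K$-linear $g$.  Multiplying $y$ by a
    unimodular scalar that makes $g(y)$ real and nonnegative turns the bound on
    the real part into one on $|g(y)|$. *)
Lemma exists_norming (a : Y) :
  exists g : {linear Y -> K^o}, (forall y, `|g y| <= `|y|) /\ re P (g a) = N a.
Proof.
have N_sub : sublinear (N : restrict_scalars (emb P) Y -> R).
  split=> [x y|t x t0]; first exact: real_normD.
  by rewrite restrict_scalarsE real_normZ ger0_norm.
have [G G_le Ga] := hahn_banach _ (a : restrict_scalars (emb P) Y) N_sub.
have [g gG] := linear_of_re P G.
exists g; split; last by rewrite gG.
move=> y; have [->|gy0] := eqVneq (g y) 0; first by rewrite normr0.
(* the unimodular scalar that rotates g y to its modulus *)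
pose c := `|g y| / g y.
have c1 : `|c| = 1 by rewrite normrM normfV normr_id divff ?normr_eq0.
have gcy : g (c *: y) = `|g y| by rewrite linearZ_LR /= /GRing.scale /= divfK.
rewrite -(reK P _ (normr_real (g y))) -gcy gG -[leRHS]mul1r -c1 -normrZ.
by rewrite -emb_real_norm ler_emb; exact: G_le.
Qed.

Lemma norming_continuous (g : {linear Y -> K^o}) :
  (forall y, `|g y| <= `|y|) -> continuous g.
Proof.
move=> g_le; apply/linear_bounded_continuous/bounded_funP => r.
by exists r => x; exact: le_trans.
Qed.

Lemma norming_dual_sphere (g : {linear Y -> K^o}) (a : Y) :
  (forall y, `|g y| <= `|y|) -> re P (g a) = N a -> a != 0 -> dual_sphere Y g.
Proof.
move=> g_le ga a0; split; first exact: norming_continuous.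
apply: dual_norm_eq1 => [y|]; first exact: le_trans.
have Na0 : `|a| != 0 by rewrite normr_eq0.
exists (`|a|^-1 *: a); first by rewrite normrZ normfV normr_id mulVf.
rewrite linearZ_LR /= normrM normfV normr_id.
suff -> : `|g a| = `|a| by rewrite mulVf.
apply/le_anti/andP; split=> //.
by rewrite -emb_real_norm -ga emb_re_le_norm.
Qed.

(** The line is the zero set of the continuous map $y \mapsto y - (g(y)/g(v)) v$,
    where $g$ is norming at $v$. *)
Lemma closed_line (v : Y) : closed_subspace [set c *: v | c in [set: K]].
Proof.
split.
  split=> [|c x y]; first by rewrite inE; exists 0; rewrite ?scale0r.
  rewrite !inE => -[a _ <-] [b _ <-].
  by exists (c * a + b); rewrite // scalerDl scalerA.
have [->|v0] := eqVneq v 0.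
  rewrite (_ : [set _ | _ in _] = [set 0]).
    exact/accessible_closed_set1/hausdorff_accessible/norm_hausdorff.
  apply/seteqP; split=> [_ [c _ <-]|_ ->] /=; first by rewrite scaler0.
  by exists 0; rewrite ?scaler0.
have [g [g_le gv]] := exists_norming v.
have gv0 : g v != 0.
  apply: contra_neq v0 => gv0; apply/eqP; rewrite -normr_eq0 -emb_real_norm -gv.
  by rewrite gv0 !raddf0.
pose h y := y - (g y / g v) *: v.
rewrite (_ : [set _ | _ in _] = h @^-1` [set 0]).
  apply: preimage_closed; last first.
    exact/accessible_closed_set1/hausdorff_accessible/norm_hausdorff.
  move=> y _; apply: (@continuousB _ _ _ id); first exact: cvg_id.
  apply: continuousZr_tmp; apply: (@continuousM K Y); last exact: cvg_cst.
  exact: norming_continuous.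
apply/seteqP; split=> [_ [c _ <-]|y] /=.
  have gZ : g (c *: v) = c * g v by exact: linearZ_LR.
  by rewrite /h gZ mulfK // subrr.
by move/subr0_eq => ->; exists (g y / g v).
Qed.

End norming.

(** * From the uniform property to uniform smoothness *)

Section smoothness.
Context {R : realType} {K : numFieldType} (P : real_part R K).
Context {Y : normedModType K}.
Local Notation N := (real_norm P).

(** Applying the property to the line through $x$ with $e/2$ gives $f$ and $c$,
    $|c| = 1$, with $f(c x) = 1$, $|1 - c| < e/2$ and $\|g - f\| < e/2$.  The
    functional $h = c f$ is norming at $x$ itself, and
    $g - h = (g - f) + (1 - c) f$. *)
Lemma BPB_one_point (re' : K -> K) (e : R) :
  (forall z, re' z = emb P (re P z)) -> uniform_BPB re' Y -> 0 < e ->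
  exists2 d : R, 0 < d & forall (x : Y) (g : {linear Y -> K^o}),
    `|x| = 1 -> dual_sphere Y g -> re P (g x) > 1 - d ->
    exists h : {linear Y -> K^o},
      [/\ forall y, `|y| <= 1 -> `|h y| <= 1, h x = 1 &
          forall y, `|y| <= 1 -> re P (g y - h y) <= e].
Proof.
move=> re'E bpb e0.
have e20 : 0 < emb P (e / 2) by rewrite -(rmorph0 (emb P)) ltr_emb; lra.
have [d d0 bpb_e] := bpb _ e20.
exists (re P d); first exact: re_gt0.
move=> x g x1 g_sph gx.
have re'gx : re' (g x) > 1 - d.
  rewrite re'E -(reK P d (gtr0_real d0)) -(rmorph1 (emb P)) -rmorphB.
  by rewrite ltr_emb.
have Xx : ([set c *: x | c in [set: K]] `&` unit_sphere Y) x.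
  by split=> //; exists 1; rewrite ?scale1r.
have [_ [f [[[[c _ /= <-] cx1] f_sph fcx] xcx gf]]] :=
  bpb_e _ (closed_line P x) x g Xx g_sph re'gx.
have f_le := dual_sphere_le P f_sph; have g_le := dual_sphere_le P g_sph.
have c1 : `|c| = 1 by move: cx1; rewrite /unit_sphere /= normrZ x1 mulr1.
have c1_lt : `|1 - c| < emb P (e / 2).
  by move: xcx; rewrite -[X in X - _]scale1r -scalerBl normrZ x1 mulr1.
have fZ (a : K) y : f (a *: y) = a * f y by exact: linearZ_LR.
pose h : {linear Y -> K^o} := f \o ( *:%R c).
have hE y : h y = c * f y by exact: fZ.
exists h; split=> [y y1||y y1].
- by rewrite hE normrM c1 mul1r f_le.
- by rewrite hE -fZ.
- apply: re_le_norm; rewrite hE.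
  have -> : g y - c * f y = (g y - f y) + (1 - c) * f y by ring.
  apply: le_trans (ler_normD _ _) _.
  rewrite (splitr e) rmorphD; apply: lerD.
    apply/ltW/(le_lt_trans _ gf).
    apply: (dual_norm_ge P (F := fun y => g y - f y) (M := 2)) => // z z1.
    apply: le_trans (ler_normB _ _) _.
    by rewrite -[2]/(1 + 1 : K); apply: lerD; [exact: g_le|exact: f_le].
  rewrite normrM -[leRHS]mulr1; apply: ler_pM => //; [exact: ltW|exact: f_le].
Qed.

(** The core estimate; [e] bounds $\mathrm{Re}\,(g - h)(y)$ for $g$ norming at $u + t y$
    and $h$ norming at $u - t y$. *)
Lemma BPB_second_difference (re' : K -> K) (e : R) :
  (forall z, re' z = emb P (re P z)) -> uniform_BPB re' Y -> 0 < e ->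
  exists2 d : R, 0 < d & forall (u y : Y) (t : R),
    `|u| = 1 -> `|y| <= 1 -> 0 < t -> t < d ->
    N (u + emb P t *: y) + N (u - emb P t *: y) <= 2 + t * e.
Proof.
move=> re'E bpb e0; have [d d0 bpb_e] := BPB_one_point _ _ re'E bpb e0.
(* Re g is at least 1 - 3t at b = u - ty, whose norm is at most 1 + t; so its
   value at b / |b| exceeds 1 - d as soon as 4t < d, while t < 1/4 keeps 1 - 3t and
   |b| positive *)
exists (Num.min (1 / 4) (d / 4)); first by rewrite lt_min; apply/andP; split; lra.
move=> u y t u1 y1 t0; rewrite lt_min => /andP[t4 td].
set a := u + _; set b := u - _.
have Nu := real_norm_unit P u u1; have Ny := real_norm_le1 P y y1.
have Nty : N (emb P t *: y) <= t.
  by rewrite real_normZ gtr0_norm// -[leRHS]mulr1 ler_pM2l.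
have Na : 1 - t <= N a.
  have := real_normD P a (- (emb P t *: y)).
  by rewrite /a addrK Nu real_normN; lra.
have Nb : 1 - t <= N b.
  by have := real_normD P b (emb P t *: y); rewrite /b subrK Nu; lra.
have Nb_le : N b <= 1 + t.
  have := real_normD P u (- (emb P t *: y)).
  by rewrite Nu real_normN -/b; lra.
have [g [g_le ga]] := exists_norming P a.
have a0 : a != 0.
  by apply/eqP => a0; move: Na; rewrite a0 /real_norm normr0 raddf0; lra.
have g_sph := norming_dual_sphere P g a g_le ga a0.
have g_ball z : `|z| <= 1 -> re P (g z) <= 1.
  by move=> z1; apply: re_le_norm; rewrite rmorph1; exact: le_trans (g_le z) z1.
have gy : re P (g y) <= 1 by exact: g_ball.
have gZ (f : {linear Y -> K^o}) (s : R) z : re P (f (emb P s *: z)) = s * re P (f z).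
  by rewrite -re_emb_mul; congr (re P _); exact: linearZ_LR.
have gE : re P (g a) = re P (g u) + t * re P (g y) by rewrite /a !raddfD gZ.
have gbE : re P (g b) = re P (g u) - t * re P (g y) by rewrite /b !raddfB gZ.
have Nb0 : 0 < N b by lra.
pose x := emb P (N b)^-1 *: b.
have bE : b = emb P (N b) *: x.
  by rewrite /x scalerA -rmorphM mulfV ?gt_eqF// rmorph1 scale1r.
have x1 : `|x| = 1.
  rewrite -(emb_real_norm P) /x real_normZ gtr0_norm ?invr_gt0//.
  by rewrite mulVf ?gt_eqF// rmorph1.
have gx : re P (g x) > 1 - d.
  rewrite /x gZ mulrC ltr_pdivlMr//.
  have tgy : t * re P (g y) <= t by rewrite -[leRHS]mulr1 ler_pM2l.
  have [d1|d1] := leP 1 d.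
    have := mulr_ge0 (_ : 0 <= d - 1) (ltW Nb0); rewrite subr_ge0 => /(_ d1).
    lra.
  have := ler_wpM2l (_ : 0 <= 1 - d) Nb_le; rewrite subr_ge0 => /(_ (ltW d1)).
  have := mulr_ge0 (ltW d0) (ltW t0); lra.
have [h [h_le hx hg]] := bpb_e x g x1 g_sph gx.
have hbE : re P (h b) = N b.
  by rewrite {1}bE gZ hx -(rmorph1 (emb P)) embK mulr1.
have hbE' : re P (h b) = re P (h u) - t * re P (h y) by rewrite /b !raddfB gZ.
have gu : re P (g u) <= 1 by apply: g_ball; rewrite u1.
have hu : re P (h u) <= 1.
  by apply: re_le_norm; rewrite rmorph1; apply: h_le; rewrite u1.
have ghy : t * (re P (g y) - re P (h y)) <= t * e.
  by rewrite ler_pM2l// -raddfB; exact: hg.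
rewrite -ga -hbE gE hbE'; lra.
Qed.

Definition right_quotients (u y : Y) : set R :=
  [set (N (u + emb P t *: y) - 1) / t | t in [set t : R | 0 < t]].

(** Monotonicity of the slopes of the convex function $r \mapsto \|u + r y\|$
    across $r = 0$. *)
Lemma left_quotient_le_right (u y : Y) (s t : R) :
  `|u| = 1 -> 0 < s -> 0 < t ->
  (1 - N (u - emb P s *: y)) / s <= (N (u + emb P t *: y) - 1) / t.
Proof.
move=> u1 s0 t0.
rewrite ler_pdivrMr// mulrAC ler_pdivlMr//.
(* triangle inequality for the convex combination of u - sy and u + ty that
   gives u, multiplied by s + t *)
have comb : emb P t *: (u - emb P s *: y) + emb P s *: (u + emb P t *: y)
    = emb P (s + t) *: u.
  rewrite scalerBr scalerDr !scalerA [emb P t * _]mulrC rmorphD scalerDl.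
  by rewrite addrACA addNr addr0 addrC.
have := real_normD P (emb P t *: (u - emb P s *: y)) (emb P s *: (u + emb P t *: y)).
rewrite comb !real_normZ (real_norm_unit P u u1).
rewrite !gtr0_norm ?addr_gt0//; lra.
Qed.

(** For $t > 0$ the infimum $l$ of the right quotients and the right quotient at
    $t$ both lie between the left and the right quotient at $t$, whose gap is
    the second difference divided by $t$.  For $t < 0$ the quotient is the left
    one at $|t|$, and the same bound applies. *)
Lemma uniformly_smooth_of_second_difference :
  (forall e : R, 0 < e -> exists2 d : R, 0 < d & forall (u y : Y) (t : R),
    `|u| = 1 -> `|y| <= 1 -> 0 < t -> t < d ->
    N (u + emb P t *: y) + N (u - emb P t *: y) <= 2 + t * e) ->
  uniformly_smooth Y.
Proof.
move=> second_diff.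
exists (fun p => emb P (inf (right_quotients p.1 p.2))).
move=> U /= /uniform_nbhs [E [entE EU]].
move: entE; rewrite -entourage_ballE => -[k /= k0 kE].
have e0 := re_gt0 P k k0.
have [d d0 d_diff] := second_diff _ (divr_gt0 e0 (ltr0n R 2)).
rewrite /within /=; apply/nbhs_ballP; exists (emb P d) => /=.
  by rewrite -(rmorph0 (emb P)) ltr_emb.
move=> a; rewrite /ball /= sub0r normrN => ad a0 a_real.
apply: EU => -[u y] [/= u1 y1]; apply: kE => /=.
rewrite /ball /= -(emb_real_norm P (u + _)) -{}(reK P a a_real).
have {ad} : `|re P a| < d by rewrite -(ltr_emb P) -normr_emb reK.
have {a0} : re P a != 0.
  by apply: contra_neq a0 => a0; rewrite -(reK P a a_real) a0 rmorph0.
move: (re P a) => t t0 td.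
rewrite -(rmorph1 (emb P)) -rmorphB -fmorphV -rmorphM -rmorphB normr_emb.
rewrite -(reK P k (gtr0_real k0)) ltr_emb.
set l := inf _.
have l_le s : 0 < s -> l <= (N (u + emb P s *: y) - 1) / s.
  move=> s0; apply: ge_inf; last by exists s.
  exists ((1 - N (u - emb P 1 *: y)) / 1) => _ [r /= r0 <-].
  exact: left_quotient_le_right.
have l_ge s : 0 < s -> (1 - N (u - emb P s *: y)) / s <= l.
  move=> s0; apply: lb_le_inf; first by eexists; exists 1 => /=.
  by move=> _ [r /= r0 <-]; exact: left_quotient_le_right.
have s0 : 0 < `|t| by rewrite normr_gt0.
have := l_le _ s0; have := l_ge _ s0; have := d_diff u y _ u1 y1 s0 td.
move: s0; set s := `|t|.
move=> s0 diff ge_l le_l.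
have gap : (N (u + emb P s *: y) - 1) / s - (1 - N (u - emb P s *: y)) / s <= re P k / 2.
  by rewrite -mulrBl ler_pdivrMr// [leRHS]mulrC; lra.
have [t_pos|t_neg] := ltP 0 t.
  have st : s = t by rewrite /s gtr0_norm.
  by rewrite -st ltr_norml; apply/andP; split; lra.
have ts : t = - s by rewrite /s ler0_norm// opprK.
have -> : (N (u + emb P t *: y) - 1) / t = (1 - N (u - emb P s *: y)) / s.
  by rewrite ts rmorphN scaleNr invrN mulrN -mulNr opprB.
by rewrite ltr_norml; apply/andP; split; lra.
Qed.

Theorem uniform_BPB_uniformly_smooth (re' : K -> K) :
  (forall z, re' z = emb P (re P z)) -> uniform_BPB re' Y -> uniformly_smooth Y.
Proof.
move=> re'E bpb; apply: uniformly_smooth_of_second_difference => e e0.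
exact: BPB_second_difference re'E bpb e0.
Qed.

End smoothness.

Theorem proposition4p10 (R : realType) :
  (forall Y : completeNormedModType R,
     uniform_BPB (fun z : R => z) Y -> uniformly_smooth Y) /\
  (forall Y : completeNormedModType R[i],
     uniform_BPB (fun z : R[i] => 'Re z) Y -> uniformly_smooth Y).
Proof.
split=> Y.
  exact: (uniform_BPB_uniformly_smooth (real_real_part R)).
apply: (uniform_BPB_uniformly_smooth (complex_real_part R)) => z.
exact: (esym (complexRe z)).
Qed.
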